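(* Let $C\subset\mathbb{R}^n$ be a compact set, let $Z$ be some open superset of $C$, and let $f:\mathbb{R}^2\times Z\to\mathbb{R}$ be continuously differentiable. Define an optimal-value function $\phi:\mathbb{R}^2\to\mathbb{R}$ by $$\phi(x):=\min\{f(x,y):y\in C\}.$$ For some particular $\hat{x}\in\mathbb{R}^2$, define the set $Y:=\{\hat{y}\in C: f(\hat{x},\hat{y})\le f(\hat{x},y)\ \ \forall y\in C\}$ and, for each $d\in\mathbb{R}^2$, define $\psi(d):=\min\{\langle d,\nabla_x f(\hat{x},y)\rangle: y\in Y\}$. Then $\phi$ is locally Lipschitz continuous and directionally differentiable, and $$\frac12\begin{bmatrix}\psi(1,0)-\psi(-1,0)\\ \psi(0,1)-\psi(0,-1)\end{bmatrix}$$ is an element of $\partial\phi(\hat{x})$.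
   Context: $\langle\cdot,\cdot\rangle$ is the Euclidean inner product, and $\nabla_x f(\hat x,y)\in\mathbb{R}^2$ is the partial gradient of $f$ with respect to its first argument. A function $\phi:\mathbb{R}^2\to\mathbb{R}$ is directionally differentiable if the one-sided limit $\phi'(x;d):=\lim_{t\downarrow 0}\frac{\phi(x+td)-\phi(x)}{t}$ exists in $\mathbb{R}$ for all $x,d\in\mathbb{R}^2$. $\partial\phi(\hat x)$ denotes Clarke's generalized gradient: for a locally Lipschitz continuous $\phi:\mathbb{R}^2\to\mathbb{R}$, $\phi^\circ(x;d):=\limsup_{z\to x,\ t\downarrow 0}\frac{\phi(z+td)-\phi(z)}{t}$ and $\partial\phi(x):=\{s\in\mathbb{R}^2:\phi^\circ(x;d)\ge\langle s,d\rangle\ \ \forall d\in\mathbb{R}^2\}$. *)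

(* Defs.v *)
From HB Require Import structures.
From mathcomp Require Import all_boot all_order all_algebra.
From mathcomp Require Import all_classical all_reals all_analysis.

Set Implicit Arguments.
Unset Strict Implicit.
Unset Printing Implicit Defensive.
Import Order.TTheory GRing.Theory Num.Theory.
Import numFieldNormedType.Exports.

Local Open Scope classical_set_scope.
Local Open Scope ring_scope.

Section Definitions.
Context {R : realType}.

Definition vec2 (a b : R) : 'rV[R]_2 := \row_(i < 2) [:: a; b]`_i.

Definition inner {m : nat} (u v : 'rV[R]_m) : R := \sum_(i < m) u 0 i * v 0 i.

Definition gradient {m : nat} (g : 'rV[R]_m -> R) (x : 'rV[R]_m) : 'rV[R]_m :=
  \row_(i < m) 'D_(delta_mx 0 i) g x.

(* Meant for open [A] only: [f] may be arbitrary outside [A], and near a point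
   of an open [A] only the values of [f] on [A] matter. In finite dimension,
   pointwise continuity of [q |-> 'd f q] is continuity in operator norm. *)
Definition continuously_differentiable_on {V : normedModType R}
    (A : set V) (f : V -> R) : Prop :=
  forall p, A p ->
    differentiable f p /\ forall v, {for p, continuous (fun q => 'd f q v)}.

(* The least element of [S] (and 0 if there is none). *)
Definition minimum (S : set R) : R := xget 0 (S `&` lbound S).

Lemma minimumE (S : set R) (m : R) : S m -> lbound S m -> minimum S = m.
Proof.
move=> Sm lbm; apply: xget_unique => // r [Sr lbr].
by apply/eqP; rewrite eq_le lbr// lbm.
Qed.

Definition locally_lipschitz {V : normedModType R} (phi : V -> R) : Prop :=
  forall x : V, exists2 U, nbhs x U & [lipschitz phi z | z in U].

Definition directionally_differentiable {V : normedModType R}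
    (phi : V -> R) : Prop :=
  forall x d : V, cvg ((phi (x + t *: d) - phi x) / t @[t --> (0 : R)^'+]).

(* Extended-real valued; finite when [phi] is locally Lipschitz. *)
Definition clarke_derivative {V : normedModType R} (phi : V -> R) (x d : V)
    : \bar R :=
  limf_esup (fun p : V * R => ((phi (p.1 + p.2 *: d) - phi p.1) / p.2)%:E)
            (filter_prod (nbhs x) (0 : R)^'+).

Definition clarke_gradient {m : nat} (phi : 'rV[R]_m -> R) (x : 'rV[R]_m)
    : set 'rV[R]_m :=
  [set s | forall d, ((inner s d)%:E <= clarke_derivative phi x d)%E].

End Definitions.

(* Main.v *)
(* By Danskin's formula, [phi'(x; d)] is the minimum of [<d, grad_x f(x, y)>] over
   the minimizers [y] of [f(x, _)]. For the last claim only one inequality is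
   needed: comparing [phi] with [f(_, y)] along backward steps [xhat - t d] gives
   [<grad_x f(xhat, y), d>] as a lower bound of the Clarke derivative, for every
   [y] in [Y]. The proposed subgradient is the centre of the bounding box of the
   planar set of gradients [grad_x f(xhat, y)], [y] in [Y], and in any direction
   [d] such a centre is dominated by one of the points where that set touches the
   sides of its box. *)
Require Import Defs.
From HB Require Import structures.
From mathcomp Require Import all_boot all_order all_algebra.
From mathcomp Require Import all_classical all_reals all_analysis.
From mathcomp Require Import ring lra.

Set Implicit Arguments.
Unset Strict Implicit.
Unset Printing Implicit Defensive.
Import Order.TTheory GRing.Theory Num.Theory.
Import numFieldNormedType.Exports.

Local Open Scope classical_set_scope.
Local Open Scope ring_scope.

(** * Mean value theorem and strict differentiability *)

Lemma diff_mean_value (R : realType) (V : normedModType R) (f : V -> R)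
    (p v : V) :
  (forall t : R, 0 <= t <= 1 -> differentiable f (p + t *: v)) ->
  exists2 t : R, 0 <= t <= 1 & f (p + v) - f p = 'd f (p + t *: v) v.
Proof.
move=> df; pose g (t : R) := f (p + t *: v).
have shiftE (t h : R) : p + (h *: 1 + t) *: v = h *: v + (p + t *: v).
  by rewrite scalerDl -scalerA scale1r addrCA.
have dg (t : R) : 0 <= t <= 1 -> is_derive t 1 g ('d f (p + t *: v) v).
  (* The difference quotient of [g] at [t] in direction 1 is literally that of [f] at [p + t *: v]
     in direction [v], so the derivative transfers. *)
  move=> /df dft; have qE : (fun h : R => h^-1 *: (g (h *: 1 + t) - g t)) =
      (fun h => h^-1 *: (f (h *: v + (p + t *: v)) - f (p + t *: v))).
    by apply/funext => h; rewrite /g shiftE.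
  split; first by rewrite /derivable /= qE; exact: diff_derivable.
  by rewrite -deriveE// /derive /= qE.
have [|||c c01 cE] := @MVT_segment R g (fun t => 'd f (p + t *: v) v) 0 1.
- exact: ler01.
- by move=> t /itvP t01; apply: dg; rewrite !t01.
- apply: derivable_within_continuous => t t01.
  by have [] := dg t; rewrite // !(itvP t01).
exists c; first by rewrite !(itvP c01).
by move: cE; rewrite /g scale1r scale0r addr0 subr0 mulr1.
Qed.

(** The mean value theorem on the segment from [q] to [q + t *: v] reduces this to continuity of
    ['d f _ v] at [p]. Letting the base point [q] vary is what makes the later compactness arguments
    possible. *)
Lemma cont_diff_strict (R : realType) (V : normedModType R) (f : V -> R)
    (A : set V) (p v : V) (e : R) :
  open A -> continuously_differentiable_on A f -> A p -> 0 < e ->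
  \forall q \near p & t \near (0 : R),
    `|f (q + t *: v) - f q - t * 'd f p v| <= e * `|t|.
Proof.
move=> oA df Ap e0; have [_ /(_ v) cdf] := df p Ap.
have /nbhs_ballP[r /= r0 pr] :
    \forall q \near p, A q /\ `|'d f p v - 'd f q v| <= e.
  apply: filterI; first exact: open_nbhs_nbhs.
  by move: cdf => /cvgrPdist_le; apply.
near=> q t => /=.
(* With [q] within [r / 2] of [p] and a step shorter than [r / 2], the segment stays in the ball
   where the derivative is controlled. *)
have near_seg (s : R) : 0 <= s <= 1 -> ball p r (q + s *: (t *: v)).
  move=> /andP[s0 s1]; rewrite -ball_normE /=.
  have -> : p - (q + s *: (t *: v)) = (p - q) - s *: (t *: v).
    by rewrite opprD addrA.
  rewrite (le_lt_trans (ler_normB _ _))// normrZ ger0_norm//.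
  have : `|p - q| < r / 2.
    by near: q; apply: cvgr_dist_lt => //; rewrite divr_gt0.
  have : `|t *: v| < r / 2.
    near: t; have : (t *: v @[t --> (0 : R)]) --> (0 : R) *: v.
      by apply: cvgZr_tmp.
    rewrite scale0r => /cvgr0_norm_lt; apply; by rewrite divr_gt0.
  have := normr_ge0 (t *: v); nra.
have [s s01 ->] := @diff_mean_value R V f q (t *: v)
  (fun s s01 => (df _ (pr _ (near_seg s s01)).1).1).
rewrite linearZ/= -mulrBr normrM mulrC ler_wpM2r// distrC.
exact: (pr _ (near_seg s s01)).2.
Unshelve. all: by end_near. Qed.

(** * Minima over compact sets, upper limits and product filters *)

Lemma minimum_image_compact (R : realType) (T : topologicalType) (A : set T)
    (g : T -> R) :
  A !=set0 -> compact A -> {within A, continuous g} ->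
  exists2 a, A a &
    minimum [set g y | y in A] = g a /\ forall y, A y -> g a <= g y.
Proof.
move=> A0 cA cg; have [a /set_mem Aa ga] := compact_EVT_min A0 cA cg.
have gmin y : A y -> g a <= g y by move=> Ay; apply: ga; exact/mem_set.
exists a => //; split=> //; apply: minimumE; first by exists a.
by move=> _ [y Ay <-]; exact: gmin.
Qed.

(** The upper limit is an infimum, over the sets of [F], of suprema, so one good point in each set
    suffices; these points may all lie on one curve. *)
Lemma limf_esup_ge (R : realType) (T : choiceType) (X : filteredType T)
    (g : X -> R) (F : set_system X) (c : R) :
  (forall A e, F A -> 0 < e -> exists2 p, A p & c - e <= g p) ->
  (c%:E <= limf_esup (fun p => (g p)%:E) F)%E.
Proof.
move=> Fc; apply/ereal_infP => _ [A FA <-].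
apply/lee_addgt0Pr => e e0; have [p Ap cp] := Fc A e FA e0.
rewrite -leeBlDr// -EFinB (@le_trans _ _ (g p)%:E) ?lee_fin//.
by apply: ereal_sup_ubound; exists p.
Qed.

(** Cover [C] with the property [Y y -> P i y], which holds vacuously near points of [C] outside
    [Y]. Closedness of [Y] is asked only at points of [C] because in the application [f] is
    controlled only on [Z]. *)
Lemma compact_sub_near (X : topologicalType) (C Y : set X) :
  compact C -> Y `<=` C ->
  (forall y, C y -> ~ Y y -> \forall z \near y, ~ Y z) -> compact Y.
Proof.
move=> /compact_near_coveringP cC YC nY; apply/compact_near_coveringP.
move=> I F P FF PY.
suff : \forall i \near F, C `<=` (fun y => Y y -> P i y).
  by apply: filterS => i CP y Yy; exact: CP (YC _ Yy) Yy.
apply: (cC I F (fun i y => Y y -> P i y)) => y Cy.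
have [Yy|nYy] := pselect (Y y).
  by apply: filterS (PY y Yy) => -[z i].
near=> z i => Yz; suff : ~ Y z by [].
by near: z; exact: nY.
Unshelve. all: by end_near. Qed.

Lemma cvg_filter_prod (T U V : Type) (F : set_system T) (G : set_system U)
    (H : set_system V) (f : T -> U) (g : T -> V) :
  Filter F -> Filter G -> Filter H ->
  f x @[x --> F] --> G -> g x @[x --> F] --> H ->
  (f x, g x) @[x --> F] --> filter_prod G H.
Proof. by move=> FF GF HF fG gH; exact: cvg_pair fG gH. Qed.

(** * Directional and Clarke derivatives of a minimum value function *)

Section MinValue.
Context {R : realType} {V W : normedModType R} (C Z : set W) (f : V * W -> R).
Context (phi : V -> R).
Context (Cc : compact C) (Zo : open Z) (CZ : C `<=` Z).
Context (df : continuously_differentiable_on ([set: V] `*` Z) f).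
Context (phi_le : forall x y, C y -> phi x <= f (x, y)).
Context (phi_attained : forall x, exists2 y, C y & phi x = f (x, y)).

Let open_dom : open ([set: V] `*` Z).
Proof.
have -> : [set: V] `*` Z = snd @^-1` Z.
  by apply/seteqP; split=> [q []//|q Zq]; split.
by apply: open_comp => // q _; exact: cvg_snd.
Qed.

Let cvg_right0 : t @[t --> (0 : R)^'+] --> (0 : R).
Proof. by apply: cvg_at_right_filter; exact: cvg_id. Qed.

Let right_pos (y0 : W) : \forall y \near y0 & t \near (0 : R)^'+, 0 < t.
Proof. exact: cvg_snd _ (nbhs_right_gt 0). Qed.

(** Strict differentiability at [(x, y0)] in direction [(d, 0)], with base points restricted to
    [(x, y)]: the slope at [y0] alone serves all nearby [y]. *)
Lemma partial_strict (x d : V) (y0 : W) (e : R) : Z y0 -> 0 < e ->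
  \forall y \near y0 & t \near (0 : R)^'+,
    `|f (x + t *: d, y) - f (x, y) - t * 'd f (x, y0) (d, 0)| <= e * t.
Proof.
move=> Zy0 e0.
have := @cont_diff_strict R _ f _ (x, y0) (d, 0) e open_dom df (conj I Zy0) e0.
have emb : ((x, yt.1), yt.2) @[yt --> filter_prod (nbhs y0) (0 : R)^'+]
    --> filter_prod (nbhs (x, y0)) (nbhs (0 : R)).
  apply: cvg_filter_prod; last first.
    exact: cvg_comp cvg_snd cvg_right0.
  apply: (@cvg_filter_prod _ _ _ _ (nbhs x) (nbhs y0)); last exact: cvg_fst.
  exact: cvg_cst.
move=> /emb near_est.
have {near_est} : filter_prod (nbhs y0) (0 : R)^'+ _ := near_est.
apply: filterS2 (right_pos y0) => -[y t] /= t0.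
have -> : (x, y) + t *: (d, 0) = (x + t *: d, y) :> V * W.
  by congr pair => /=; rewrite scaler0 addr0.
by rewrite (gtr0_norm t0).
Qed.

Lemma cont_slice (x : V) (y : W) :
  Z y -> {for y, continuous (fun z => f (x, z))}.
Proof.
move=> Zy; have [/differentiable_continuous fc _] := df (conj I Zy : _ (x, y)).
apply: (@continuous_comp _ _ _ (fun z => (x, z)) f) => //.
apply: (@cvg_filter_prod _ _ _ _ (nbhs x) (nbhs y)); last exact: cvg_id.
exact: cvg_cst.
Qed.

Lemma cont_diff_slice (x d : V) (y : W) :
  Z y -> {for y, continuous (fun z => 'd f (x, z) (d, 0))}.
Proof.
move=> Zy; have [_ /(_ (d, 0)) dc] := df (conj I Zy : _ (x, y)).
apply: (@continuous_comp _ _ _ (fun z => (x, z))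
  (fun q => 'd f q (d, 0))) => //.
apply: (@cvg_filter_prod _ _ _ _ (nbhs x) (nbhs y)); last exact: cvg_id.
exact: cvg_cst.
Qed.

Definition minimizers (x : V) : set W := [set y | C y /\ f (x, y) = phi x].

Lemma minimizers_nonempty x : minimizers x !=set0.
Proof. by have [y Cy phiE] := phi_attained x; exists y. Qed.

(** At points of [C], failing to be a minimizer is an open condition, by continuity of
    [f (x, _)]. *)
Lemma minimizers_compact x : compact (minimizers x).
Proof.
apply: (@compact_sub_near _ C) => // [y []//|y Cy nYy].
have fy : f (x, y) != phi x by apply/eqP => fE; apply: nYy.
have : \forall z \near y, f (x, z) != phi x.
  apply: (@cont_slice x _ (CZ Cy) [set r | r != phi x]).
  by apply: open_nbhs_nbhs; split=> //; exact: open_neq.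
by apply: filterS => z /eqP fz [_ /fz].
Qed.

(* Danskin's formula. The lower bound holds locally uniformly around every [y] in
   [C], by the strict derivative if [y] is a minimizer and by continuity of [f] if
   not, hence uniformly on the compact set [C]. *)
Lemma min_value_dir_derivative (x d : V) (y0 : W) :
  minimizers x y0 ->
  (forall y, minimizers x y -> 'd f (x, y0) (d, 0) <= 'd f (x, y) (d, 0)) ->
  (phi (x + t *: d) - phi x) / t @[t --> (0 : R)^'+] --> 'd f (x, y0) (d, 0).
Proof.
move=> [Cy0 fy0] y0min; set c := 'd f (x, y0) (d, 0) in y0min *.
apply/cvgrPdist_le => e e0.
(* Since [phi (x + t *: d) <= f (x + t *: d, y0)], this will bound the quotient from above. *)
have upper : \forall t \near (0 : R)^'+,
    `|f (x + t *: d, y0) - f (x, y0) - t * c| <= e * t.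
  have emb : (y0, t) @[t --> (0 : R)^'+]
      --> filter_prod (nbhs y0) (0 : R)^'+.
    by apply: cvg_filter_prod; [exact: cvg_cst | exact: cvg_id].
  exact: emb _ (partial_strict x d (CZ Cy0) e0).
clearbody c; have lower : \forall t \near (0 : R)^'+,
    C `<=` (fun y => C y -> phi x + t * c - e * t <= f (x + t *: d, y)).
  move: Cc => /compact_near_coveringP; apply => y Cy.
  have [fy|fy] := eqVneq (f (x, y)) (phi x).
    move: (partial_strict x d (CZ Cy) e0) (y0min y (conj Cy fy)).
    move: ('d f (x, y) (d, 0)) => D est cD.
    apply: filterS2 (right_pos y) est => -[z t] /= t0 + Cz.
    have := phi_le x Cz; have : t * c <= t * D by rewrite ler_pM2l.
    by move=> ? ? /ler_normlP[]; lra.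
  have fx : phi x < f (x, y) by rewrite lt_neqAle eq_sym fy phi_le.
  (* The desired bound at [(z, t)] reads [phi x <= h (z, t)], and [h] tends to [f (x, y)], which
     exceeds [phi x]. *)
  pose h (q : W * R) := f (x + q.2 *: d, q.1) - q.2 * c + e * q.2.
  have hc : h q @[q --> filter_prod (nbhs y) (0 : R)^'+] --> f (x, y).
    have -> : f (x, y) = f (x + 0 *: d, y) - 0 * c + e * 0.
      by rewrite scale0r addr0 mul0r subr0 mulr0 addr0.
    have c2 : q.2 @[q --> filter_prod (nbhs y) (0 : R)^'+] --> (0 : R).
      exact: cvg_comp cvg_snd cvg_right0.
    apply: cvgD; last by apply: cvgM => //; exact: cvg_cst.
    apply: cvgB; last by apply: cvgM => //; exact: cvg_cst.
    have [/differentiable_continuous fc _] :=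
      df (conj I (CZ Cy) : _ (x + 0 *: d, y)).
    apply: (@cvg_comp _ _ _ (fun q : W * R => (x + q.2 *: d, q.1)) f _
      (nbhs (x + 0 *: d, y))); last exact: fc.
    apply: (@cvg_filter_prod _ _ _ _ (nbhs (x + 0 *: d)) (nbhs y));
      last exact: cvg_fst.
    by apply: cvgD; [exact: cvg_cst | exact: cvgZr_tmp].
  by apply: filterS (cvgr_gt _ hc _ fx) => -[z t] /=; rewrite /h /=; lra.
near=> t; have t0 : 0 < t by near: t; exact: nbhs_right_gt.
have [y Cy phiy] := phi_attained (x + t *: d).
have : `|f (x + t *: d, y0) - f (x, y0) - t * c| <= e * t by near: t.
have : phi x + t * c - e * t <= f (x + t *: d, y).
  by move: (y) (Cy) (Cy); near: t.
have := phi_le (x + t *: d) Cy0.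
rewrite -phiy fy0 => le_up le_lo /ler_normlP[_ abs_up].
have -> : c - (phi (x + t *: d) - phi x) / t =
    (t * c - (phi (x + t *: d) - phi x)) / t by field; exact: lt0r_neq0.
rewrite normrM normfV (gtr0_norm t0) ler_pdivrMr// ler_norml.
by apply/andP; split; lra.
Unshelve. all: by end_near. Qed.

(** The continuous slope ['d f (x, y) (d, 0)] attains its minimum over the compact set of
    minimizers, which supplies the [y0] of Danskin's formula. *)
Lemma min_value_directionally_differentiable : directionally_differentiable phi.
Proof.
move=> x d.
have [|y Yy [_ ymin]] := minimum_image_compact (minimizers_nonempty x)
    (@minimizers_compact x) (g := fun y => 'd f (x, y) (d, 0)).
  apply: continuous_in_subspaceT => y /set_mem[Cy _].
  exact: cont_diff_slice (CZ Cy).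
by apply/cvg_ex; exists ('d f (x, y) (d, 0)); exact: min_value_dir_derivative.
Qed.

(* Backward quotients [(phi x - phi (x - t d)) / t] are bounded below by those
   of [f (_, y)], since [phi (x - t d) <= f (x - t d, y)]. *)
Lemma clarke_derivative_ge (x d : V) (y : W) : minimizers x y ->
  (('d f (x, y) (d, 0))%:E <= clarke_derivative phi x d)%E.
Proof.
move=> [Cy fy]; apply: limf_esup_ge => A e FA e0.
have emb : (y, t) @[t --> (0 : R)^'+] --> filter_prod (nbhs y) (0 : R)^'+.
  by apply: cvg_filter_prod; [exact: cvg_cst | exact: cvg_id].
have est := emb _ (partial_strict x (- d) (CZ Cy) e0).
have back : (x + t *: - d, t) @[t --> (0 : R)^'+]
    --> filter_prod (nbhs x) (0 : R)^'+.
  apply: cvg_filter_prod; last exact: cvg_id.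
  have {2}-> : x = x + 0 *: - d by rewrite scale0r addr0.
  by apply: cvgD; [exact: cvg_cst | exact: cvgZr_tmp].
near (0 : R)^'+ => t; have t0 : 0 < t by near: t; exact: nbhs_right_gt.
exists (x + t *: - d, t); first by near: t; exact: back.
(* From the base point [x - t *: d] the forward step returns to [x], which produces the backward
   quotient. *)
rewrite /= scalerN subrK.
have : `|f (x + t *: - d, y) - f (x, y) - t * 'd f (x, y) (- d, 0)| <= e * t.
  by near: t.
have -> : (- d, 0) = - (d, 0) :> V * W by congr pair; rewrite /= oppr0.
rewrite !linearN/= fy => /ler_normlP[_].
have := phi_le (x - t *: d) Cy.
by rewrite ler_pdivlMr//; lra.
Unshelve. all: by end_near. Qed.

End MinValue.

(** * Partial gradients in coordinates and local Lipschitz continuity *)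

Lemma derive_slice (R : realType) (V W : normedModType R)
    (g : V * W -> R) (x v : V) (y : W) :
  differentiable g (x, y) ->
  'D_v (fun x' => g (x', y)) x = 'd g (x, y) (v, 0).
Proof.
have qE : (fun h : R => h^-1 *: (g (h *: v + x, y) - g (x, y))) =
    (fun h => h^-1 *: (g (h *: (v, 0) + (x, y)) - g (x, y))).
  apply/funext => h; congr (_ *: (g _ - _)).
  by congr pair; rewrite /= scaler0 add0r.
by move=> dg; rewrite -deriveE// /derive /= qE.
Qed.

Section PartialGradient.
Context {R : realType} {m : nat} {W : normedModType R}.
Context (f : 'rV[R]_m * W -> R).

Lemma diff_row_sum (p : 'rV[R]_m * W) (v : 'rV[R]_m) :
  'd f p (v, 0) = \sum_(i < m) v 0 i * 'd f p (delta_mx 0 i, 0).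
Proof.
have pairD (u w : 'rV[R]_m) : (u + w, 0) = (u, 0) + (w, 0) :> _ * W.
  by congr pair; rewrite /= addr0.
have pairZ (a : R) (u : 'rV[R]_m) : (a *: u, 0) = a *: (u, 0) :> _ * W.
  by congr pair; rewrite /= scaler0.
rewrite [in LHS](row_sum_delta v).
rewrite (big_morph (fun u => 'd f p (u, 0)) (id1 := 0) (op1 := +%R)).
- by apply: eq_bigr => i _; rewrite pairZ linearZ.
- by move=> u w; rewrite pairD linearD.
- exact: linear0.
Qed.

Lemma inner_gradient_slice (d x : 'rV[R]_m) (y : W) :
  differentiable f (x, y) ->
  inner d (gradient (fun x' => f (x', y)) x) = 'd f (x, y) (d, 0).
Proof.
move=> dfxy; rewrite diff_row_sum; apply: eq_bigr => i _.
by rewrite mxE derive_slice.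
Qed.

(** Rows carry the maximum norm, so every [|v 0 i|] is at most [|v|]. *)
Lemma diff_row_le (p : 'rV[R]_m * W) (v : 'rV[R]_m) :
  'd f p (v, 0) <= (\sum_(i < m) `|'d f p (delta_mx 0 i, 0)|) * `|v|.
Proof.
rewrite diff_row_sum mulr_suml; apply: ler_sum => i _.
rewrite (le_trans (ler_norm _))// normrM mulrC ler_wpM2l//.
rewrite [leRHS]mx_normrE.
exact: (le_bigmax _ (fun ij => `|v ij.1 ij.2|) (0, i)).
Qed.

End PartialGradient.

(** By compactness one constant [M] bounds the partial derivatives in [x] over all of [C] near [x0].
    Each [f (_, y)] is then [M]-Lipschitz on a common ball, and the minimum inherits the
    constant. *)
Lemma min_value_locally_lipschitz (R : realType) (m : nat)
    (W : normedModType R) (C Z : set W) (f : 'rV[R]_m * W -> R)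
    (phi : 'rV[R]_m -> R) :
  compact C -> C `<=` Z ->
  continuously_differentiable_on ([set: 'rV[R]_m] `*` Z) f ->
  (forall x y, C y -> phi x <= f (x, y)) ->
  (forall x, exists2 y, C y & phi x = f (x, y)) ->
  locally_lipschitz phi.
Proof.
move=> /compact_near_coveringP Cc CZ df phi_le phi_at x0.
pose S q := \sum_(i < m) `|'d f q (delta_mx 0 i, 0)|.
(* The local bound [S (x0, y) + 1] depends on [y]. Treating the constant as a variable tending to
   [+oo], jointly with [x] tending to [x0], lets the covering property produce one bound for all of
   [C]. *)
have [[A B] /= [FA FB] AB] : filter_prod (+oo : set_system R) (nbhs x0)
    (fun i => C `<=` (fun y => S (i.2, y) <= i.1)).
  apply: (Cc _ (filter_prod (+oo : set_system R) (nbhs x0))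
    (fun i y => S (i.2, y) <= i.1)) => y Cy.
  have Sc : S q @[q --> (x0, y)] --> S (x0, y).
    apply: cvg_big => [|i _]; first exact: add_continuous.
    by apply: cvg_norm; have [_] := df (x0, y) (conj I (CZ _ Cy)); apply.
  have emb : (p.2.2, p.1)
      @[p --> filter_prod (nbhs y) (filter_prod (+oo : set_system R) (nbhs x0))]
      --> filter_prod (nbhs x0) (nbhs y).
    by apply: cvg_filter_prod; [exact: cvg_comp cvg_snd cvg_snd|exact: cvg_fst].
  have near_S : filter_prod (nbhs y)
      (filter_prod (+oo : set_system R) (nbhs x0))
      (fun p => S (p.2.2, p.1) < S (x0, y) + 1).
    have S1 : S (x0, y) < S (x0, y) + 1 by rewrite ltrDl.
    exact: emb _ (cvgr_lt _ Sc _ S1).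
  have near_M : filter_prod (nbhs y)
      (filter_prod (+oo : set_system R) (nbhs x0))
      (fun p => S (x0, y) + 1 <= p.2.1).
    have emb_M : p.2.1
        @[p --> filter_prod (nbhs y) (filter_prod (+oo : set_system R) (nbhs x0))]
        --> (+oo : set_system R) by exact: cvg_comp cvg_snd cvg_fst.
    exact: emb_M _ (nbhs_pinfty_ge (num_real _)).
  by apply: filterS2 near_S near_M => -[z [M x]] /= /ltW; exact: le_trans.
have [M AM] := filter_ex FA.
have /nbhs_ballP[r /= r0 rB] := FB.
exists (ball x0 r); first exact: nbhsx_ballx.
have lip x z : ball x0 r x -> ball x0 r z -> phi x - phi z <= M * `|x - z|.
  rewrite -ball_normE /= => x0x x0z.
  (* A minimizer at [z] is a competitor at [x], so [phi x - phi z <= f (x, y) - f (z, y)]. *)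
  have [y Cy ->] := phi_at z.
  rewrite (le_trans (lerB (phi_le x y Cy) (lexx _)))//.
  have segE t : (z, y) + t *: (x - z, 0) = (z + t *: (x - z), y)
      :> 'rV[R]_m * W.
    by congr pair; rewrite /= scaler0 addr0.
  have [|t /andP[t0 t1]] := @diff_mean_value R _ f (z, y) (x - z, 0).
    by move=> t _; rewrite segE; have [] := df (z + t *: (x - z), y)
      (conj I (CZ _ Cy)).
  have -> : (z, y) + (x - z, 0) = (x, y) :> 'rV[R]_m * W.
    by congr pair; rewrite /= ?addr0 ?subrKC.
  rewrite segE => ->; apply: (le_trans (diff_row_le _ _ _)).
  rewrite ler_wpM2r//; apply: (AB (M, z + t *: (x - z))) => //=; split=> //.
  apply: rB; rewrite -ball_normE /=.
  (* A convex combination, so the intermediate point stays in the ball. *)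
  have -> : x0 - (z + t *: (x - z)) = (1 - t) *: (x0 - z) + t *: (x0 - x).
    rewrite scalerBl scale1r !scalerBr.
    by apply/matrixP => i j; rewrite !mxE; ring.
  rewrite (le_lt_trans (ler_normD _ _))// !normrZ (ger0_norm t0).
  rewrite ger0_norm ?subr_ge0//.
  by move: t0; rewrite le_eqVlt => /predU1P[<-|t0]; nra.
apply: (@klipschitzW _ _ _ M).
  apply: (@globally_properfilter _ _ (x0, x0)).
  by split; exact: ballxx.
move=> [x z] /= [Ux Uz]; rewrite ler_norml lip// andbT lerNl opprB distrC.
exact: lip.
Qed.

(* Normalise the box to be centred at [0]. If [|v| * height <= |u| * width], then
   a point on the left or the right side, chosen by the sign of [u], works
   whatever its second coordinate; otherwise use the top or the bottom. *)
Lemma box_center_le (R : realFieldType) (T : Type) (Y : set T) (g1 g2 : T -> R)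
    (l r b t : T) (u v : R) :
  Y l -> Y r -> Y b -> Y t ->
  (forall y, Y y -> g1 l <= g1 y <= g1 r) ->
  (forall y, Y y -> g2 b <= g2 y <= g2 t) ->
  exists2 y, Y y &
    (g1 l + g1 r) / 2 * u + (g2 b + g2 t) / 2 * v <= g1 y * u + g2 y * v.
Proof.
move=> Yl Yr Yb Yt box1 box2.
move: (box1 _ Yb) (box1 _ Yt) (box2 _ Yl) (box2 _ Yr) => {box1 box2}.
move=> /andP[b1 b2] /andP[t1 t2] /andP[l1 l2] /andP[r1 r2].
have [wide|/ltW tall] := leP (`|v| * (g2 t - g2 b)) (`|u| * (g1 r - g1 l)).
(* The first coordinate gains [|u| * width / 2] over the centre, while the second loses at most
   [|v| * height / 2]. *)
- have [u0|/ltW u0] := leP 0 u; [exists r|exists l] => //; move: wide;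
    rewrite ?(ger0_norm u0) ?(ler0_norm u0);
    have [v0|v0] := leP 0 v;
    rewrite ?(ger0_norm v0) ?(ltr0_norm v0); nra.
- have [v0|/ltW v0] := leP 0 v; [exists t|exists b] => //; move: tall;
    rewrite ?(ger0_norm v0) ?(ler0_norm v0);
    have [u0|u0] := leP 0 u;
    rewrite ?(ger0_norm u0) ?(ltr0_norm u0); nra.
Qed.

(** * Application to the plane *)

Lemma inner2E (R : realType) (u v : 'rV[R]_2) :
  inner u v = u 0 0 * v 0 0 + u 0 1 * v 0 1.
Proof. by rewrite /inner big_ord_recl big_ord1; congr (_ + u 0 _ * v 0 _);
  exact/val_inj. Qed.

Theorem proposition4p8 (R : realType) (n : nat) (C Z : set 'rV[R]_n)
    (f : 'rV[R]_2 * 'rV[R]_n -> R) (xhat : 'rV[R]_2) :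
  C !=set0 -> compact C -> open Z -> C `<=` Z ->
  continuously_differentiable_on ([set: 'rV[R]_2] `*` Z) f ->
  let phi := fun x : 'rV[R]_2 => minimum [set f (x, y) | y in C] in
  let Y := [set yhat | C yhat /\
                       forall y, C y -> f (xhat, yhat) <= f (xhat, y)] in
  let psi := fun d : 'rV[R]_2 =>
    minimum [set inner d (gradient (fun x => f (x, y)) xhat) | y in Y] in
  [/\ locally_lipschitz phi,
      directionally_differentiable phi &
      clarke_gradient phi xhat
        (2^-1 *: vec2 (psi (vec2 1 0) - psi (vec2 (-1) 0))
                      (psi (vec2 0 1) - psi (vec2 0 (-1))))].
Proof.
move=> C0 Cc Zo CZ df phi Y psi.
have fc x y : C y -> {for y, continuous (fun z => f (x, z))}.
  move=> Cy; exact: (cont_slice df (CZ _ Cy)).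
(* As [C] is nonempty and compact, the minimum is attained and the default value 0 of [minimum]
   never occurs. *)
have phi_min x : exists2 y, C y &
    phi x = f (x, y) /\ forall z, C z -> f (x, y) <= f (x, z).
  apply: minimum_image_compact => //.
  by apply: continuous_in_subspaceT => y /set_mem; exact: fc.
have phi_le x y : C y -> phi x <= f (x, y).
  by have [z Cz [-> zmin]] := phi_min x; exact: zmin.
have phi_at x : exists2 y, C y & phi x = f (x, y).
  by have [z Cz [? _]] := phi_min x; exists z.
have YE : Y = minimizers C f phi xhat.
  apply/seteqP; split=> y [Cy ymin]; split=> //.
    apply/eqP; rewrite eq_le phi_le// andbT.
    by have [z Cz ->] := phi_at xhat; exact: ymin.
  by move=> z Cz; rewrite ymin; exact: phi_le.
pose g d y := inner d (gradient (fun x => f (x, y)) xhat).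
have gE d y : Y y -> g d y = 'd f (xhat, y) (d, 0).
  move=> [Cy _]; apply: inner_gradient_slice.
  by have [] := df (xhat, y) (conj I (CZ _ Cy)).
have psi_min d : exists2 y, Y y &
    psi d = g d y /\ forall z, Y z -> g d y <= g d z.
  have [|y Yy [yE ymin]] := minimum_image_compact
    (minimizers_nonempty phi_at xhat) (minimizers_compact Cc CZ df (x := xhat))
    (g := fun y => 'd f (xhat, y) (d, 0)).
    apply: continuous_in_subspaceT => y /set_mem[Cy _].
    exact: (cont_diff_slice df (CZ _ Cy)).
  rewrite -YE in Yy yE ymin.
  exists y; first exact: Yy.
  split; last by move=> z Yz; rewrite (gE d y Yy) (gE d z Yz); exact: ymin.
  by rewrite (gE d y Yy) -yE; congr minimum; exact: eq_imagel (gE d).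
split.
- exact: min_value_locally_lipschitz Cc CZ df phi_le phi_at.
- exact: min_value_directionally_differentiable Cc Zo CZ df phi_le phi_at.
move=> d /=.
(* Minimizing the negative of a partial derivative locates its maximum, so each difference of two
   [psi] values is the minimum plus the maximum of one coordinate of the gradient, twice the centre
   of its range. *)
have [l Yl [lE lmin]] := psi_min (vec2 1 0).
have [r Yr [rE rmax]] := psi_min (vec2 (-1) 0).
have [b Yb [bE bmin]] := psi_min (vec2 0 1).
have [t Yt [tE tmax]] := psi_min (vec2 0 (-1)).
pose G y := gradient (fun x => f (x, y)) xhat.
have g_vec2 a c y : g (vec2 a c) y = a * G y 0 0 + c * G y 0 1.
  by rewrite /g inner2E !mxE.
rewrite !g_vec2 in lE rE bE tE.
have [] := @box_center_le R _ Y (fun y => G y 0 0) (fun y => G y 0 1) l r b t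
  (d 0 0) (d 0 1) Yl Yr Yb Yt.
- move=> y Yy; move: (lmin y Yy) (rmax y Yy); rewrite !g_vec2.
  by rewrite !mulN1r !mul1r !mul0r !addr0 lerN2 => -> ->.
- move=> y Yy; move: (bmin y Yy) (tmax y Yy); rewrite !g_vec2.
  by rewrite !mulN1r !mul1r !mul0r !add0r lerN2 => -> ->.
move=> y Yy center_le.
(* The point [y] chosen for the direction [d] mediates: its slope is below the Clarke derivative and
   above the pairing with the centre. *)
apply: le_trans (clarke_derivative_ge Zo CZ df phi_le d _); last first.
  by rewrite -YE; exact: Yy.
rewrite -(gE d y Yy) lee_fin; set s := _ *: _.
have s0 : s 0 0 = 2^-1 * (psi (vec2 1 0) - psi (vec2 (-1) 0)) by rewrite !mxE.
have s1 : s 0 1 = 2^-1 * (psi (vec2 0 1) - psi (vec2 0 (-1))) by rewrite !mxE.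
rewrite /g !inner2E s0 s1 lE rE bE tE -/(G y).
have -> : d 0 0 * G y 0 0 + d 0 1 * G y 0 1 = G y 0 0 * d 0 0 + G y 0 1 * d 0 1.
  by rewrite ![d _ _ * _]mulrC.
apply: le_trans center_le; rewrite le_eqVlt; apply/orP; left; apply/eqP.
by move: (G l 0 0) (G r 0 0) (G b 0 1) (G t 0 1) => *; field.
Qed.
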